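(* Let $K$ be a non-Archimedean local field with residue field of cardinality $q$ and normalized absolute value $|\cdot|_K$, let $\alpha>0$, $u_0\in\mathbb R$, and let $f:\ q^{\mathbb Z}\times\mathbb R\to\mathbb R$ satisfy, with some constants $M,F>0$, $$|f(|t|_K,x)|\le M,\qquad |f(|t|_K,x)-f(|t|_K,y)|\le F|x-y|$$ for all $t\in K\setminus\{0\}$ and $x,y\in\mathbb R$. Then the Cauchy problem $$(D^\alpha u)(|t|_K)=f(|t|_K,u(|t|_K)),\quad 0\ne t\in K,\qquad u(0)=u_0,$$ has a unique local mild solution. That is, the integral equation $$u(|t|_K)=u_0+I^\alpha\big[f(|\cdot|_K,u(|\cdot|_K))\big](|t|_K)$$ has a real-valued radial solution $u(|t|_K)$ defined for $|t|_K\le q^N$, where $N\in\mathbb Z$ is sufficiently small; and another local solution $\overline u(|t|_K)$ (a radial real-valued solution of the same integral equation on some ball centered at the origin), if it exists, coincides with $u$ for $|t|_K\le q^{\overline N}$, for some $\overline N\in\mathbb Z$, $\overline N\le N$.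
   Context: $K$ is a non-Archimedean local field (a non-discrete totally disconnected locally compact topological field); the normalized absolute value satisfies $|\beta|_K=q^{-1}$ for a generator $\beta$ of the maximal ideal of the ring of integers $O=\{x\in K:|x|_K\le 1\}$, and takes the values $0$ and $q^n$, $n\in\mathbb Z$. $dx$ is the Haar measure on the additive group of $K$ with $\int_O dx=1$. A radial function is a function of the form $x\mapsto u(|x|_K)$; it is identified with the function $|x|_K\mapsto u(|x|_K)$ on $q^{\mathbb Z}$ (together with its value $u(0)$ at the origin). The operator $D^\alpha$ (Vladimirov's operator) is $$(D^\alpha u)(x)=\frac{1-q^\alpha}{1-q^{-\alpha-1}}\int_K|y|_K^{-\alpha-1}[u(x-y)-u(x)]\,dy .$$ The operator $I^\alpha$ is defined by $(I^\alpha\varphi)(0)=0$ and, for $x\neq 0$, $$(I^\alpha\varphi)(x)=\frac{1-q^{-\alpha}}{1-q^{\alpha-1}}\int_{|y|_K\le|x|_K}\big(|x-y|_K^{\alpha-1}-|y|_K^{\alpha-1}\big)\varphi(y)\,dy,\quad\alpha\ne1,$$ $$(I^1\varphi)(x)=\frac{1-q}{q\log q}\int_{|y|_K\le|x|_K}\big(\log|x-y|_K-\log|y|_K\big)\varphi(y)\,dy .$$ For a radial function $\varphi=\varphi(|x|_K)$ with $\sum_{k\le m}\max(q^k,q^{\alpha k})|\varphi(q^k)|<\infty$ (if $\alpha\ne1$), respectively $\sum_{k\le m}|k|q^k|\varphi(q^k)|<\infty$ (if $\alpha=1$), for some $m\in\mathbb Z$, the function $I^\alpha\varphi$ exists and is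 radial, and for $x\ne0$ $$(I^\alpha\varphi)(|x|_K)=q^{-\alpha}|x|_K^\alpha\varphi(|x|_K)+\frac{1-q^{-\alpha}}{1-q^{\alpha-1}}\int_{|y|_K<|x|_K}\big(|x|_K^{\alpha-1}-|y|_K^{\alpha-1}\big)\varphi(|y|_K)\,dy,\quad\alpha\neq1,$$ $$(I^1\varphi)(|x|_K)=q^{-1}|x|_K\varphi(|x|_K)+\frac{1-q}{q\log q}\int_{|y|_K<|x|_K}\big(\log|x|_K-\log|y|_K\big)\varphi(|y|_K)\,dy .$$ Computing $(I^\alpha\varphi)(|t|_K)$ for $|t|_K\le q^m$ requires only the values of $\varphi$ on $\{0<|t|_K\le q^m\}$, so local solutions of the integral equation (solutions on a ball $\{|t|_K\le q^m\}$) make sense. A solution of the integral equation is called a mild solution of the Cauchy problem. *)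

(* Defs.v *)
From HB Require Import structures.
From mathcomp Require Import all_boot all_order all_algebra.
From mathcomp Require Import all_classical all_reals all_analysis.

Set Implicit Arguments.
Unset Strict Implicit.
Unset Printing Implicit Defensive.

Import Order.TTheory GRing.Theory Num.Theory.
Import numFieldNormedType.Exports.

Local Open Scope classical_set_scope.
Local Open Scope ring_scope.

HB.mixin Record TopologicalZmodule_isTopologicalField K
    & TopologicalZmodule K & GRing.Field K := {
  topfield_mul_continuous : continuous (fun z : K * K => z.1 * z.2) ;
  topfield_inv_continuous :
    forall x : K, x != 0 -> {for x, continuous (fun y : K => y^-1)}
}.

#[short(type="topologicalFieldType")]
HB.structure Definition TopologicalField :=
  {K of TopologicalZmodule K & GRing.Field K
        & TopologicalZmodule_isTopologicalField K}.

(* Hausdorffness is not listed: it follows from total disconnectedness. *)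
Record nonarch_local_field (K : topologicalFieldType) : Prop := {
  local_field_nondiscrete : ~ (forall x : K, open [set x]) ;
  local_field_totally_disconnected : totally_disconnected [set: K] ;
  local_field_locally_compact : locally_compact [set: K]
}.

Section AbsoluteValue.
Variables (R : realType) (K : topologicalFieldType) (abs : K -> R).

Definition integer_ring : set K := [set x | abs x <= 1].

Definition maximal_ideal : set K := [set x | abs x < 1].

(* The residue field O/P, as the set of cosets x + P with x in O. *)
Definition residue_cosets : set (set K) :=
  [set [set x + p | p in maximal_ideal] | x in integer_ring].

Record normalized_abs (q : nat) : Prop := {
  abs_ge0 : forall x, 0 <= abs x ;
  abs_eq0 : forall x, abs x = 0 <-> x = 0 ;
  abs_mul : forall x y, abs (x * y) = abs x * abs y ;
  abs_ultrametric : forall x y, abs (x + y) <= Num.max (abs x) (abs y) ;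
  abs_topology : forall (x : K) (A : set K),
    nbhs x A <-> exists2 e : R, 0 < e & [set y | abs (y - x) < e] `<=` A ;
  abs_residue : (residue_cosets #= `I_q)%card ;
  abs_uniformizer : exists2 beta : K,
    maximal_ideal = [set beta * x | x in integer_ring] & abs beta = q%:R^-1
}.

End AbsoluteValue.

(* Copy of K pointed at 0: measurable types are required to be pointed. *)
Definition pointed_field (K : topologicalFieldType) : Type := K.

HB.instance Definition _ (K : topologicalFieldType) :=
  Choice.copy (pointed_field K) K.
HB.instance Definition _ (K : topologicalFieldType) :=
  isPointed.Build (pointed_field K) (0 : K).

Notation borel K := (@g_sigma_algebraType (pointed_field K) (@open K)).

(* Regularity is not listed: K is locally compact, separable and metrizable,
   so every Borel measure finite on compact sets is regular. *)
Record normalized_haar (R : realType) (K : topologicalFieldType)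
    (abs : K -> R) (mu : {measure set (borel K) -> \bar R}) : Prop := {
  haar_translation : forall (x : K) (A : set (borel K)), measurable A ->
    mu [set x + a | a in (A : set K)] = mu A ;
  haar_compact : forall A : set K, compact A -> (mu A < +oo)%E ;
  haar_integer_ring : mu (integer_ring abs) = 1%E
}.

Section Ialpha.
Variables (R : realType) (K : topologicalFieldType) (q : nat) (abs : K -> R)
  (mu : {measure set (borel K) -> \bar R}) (alpha : R).

(* At y = 0 and y = x, [powR] and [ln] take conventional values; these two
   points are Haar-null. *)
Definition Ialpha_kernel (x y : K) : R :=
  if alpha == 1 then ln (abs (x - y)) - ln (abs y)
  else abs (x - y) `^ (alpha - 1) - abs y `^ (alpha - 1).

Definition Ialpha_const : R :=
  if alpha == 1 then (1 - q%:R) / (q%:R * ln q%:R)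
  else (1 - q%:R `^ (- alpha)) / (1 - q%:R `^ (alpha - 1)).

Definition Ialpha_exists (phi : K -> R) (x : K) : Prop :=
  x != 0 -> mu.-integrable [set y : borel K | abs y <= abs x]
              (fun y => (Ialpha_kernel x y * phi y)%:E).

Definition Ialpha (phi : K -> R) (x : K) : R :=
  if x == 0 then 0
  else Ialpha_const *
    \int[mu]_(y in [set y : borel K | abs y <= abs x])
      (Ialpha_kernel x y * phi y).

(* The radial function t |-> u (abs t) solves the integral equation on the
   ball abs t <= q ^ N. Only the values of u at 0 and at q ^ k, k <= N, matter;
   the value of f (0, _) is used only on the null set {0}. *)
Definition local_mild_solution (f : R -> R -> R) (u0 : R) (N : int)
    (u : R -> R) : Prop :=
  forall t : K, abs t <= q%:R ^ N ->
    let phi := fun y : K => f (abs y) (u (abs y)) in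
    Ialpha_exists phi t /\ u (abs t) = u0 + Ialpha phi t.

End Ialpha.

(* Main.v *)
Require Import Defs.
From HB Require Import structures.
From mathcomp Require Import all_boot all_order all_algebra.
From mathcomp Require Import all_classical all_reals all_analysis.
From mathcomp Require Import measurable_realfun lra.

(** The proof is Picard iteration on a small ball around the origin, and it
rests on two properties of [Ialpha] acting on bounded radial functions.

Smallness: the kernel is a difference [g |x - y| - g |y|] of two copies of one
radial profile [g], which is [ln] or a power, and near the origin [g] is
dominated by [C * r `^ (d - 1)] for some [d > 0]. A ball of radius [q ^ - n] has
Haar measure at most [q ^ - n], because the [q] residue classes cut each ball
into [q] disjoint translates of the next one. Summing [g] over the spheres
inside [|y| <= |x|] gives a geometric series of order [|x| `^ d]
([integral_radial_le]). Translation by [x] maps this ball to itself, so the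
kernel satisfies the same estimate up to a factor [2], and the norm of [Ialpha]
tends to [0] with the radius of the ball ([Ialpha_small]).

Radiality: by the same translation, the integral of the kernel over
[|y| <= |x|] is [0]. Hence the constant [phi x] may be subtracted from [phi]
under the integral; what is left vanishes on the sphere [|y| = |x|], and inside
this sphere [|x - y| = |x|]. The result depends on [|x|] only
([Ialpha_radialE]).

Given these, on a ball where [F] times the norm of [Ialpha] is at most one half,
the map [u |-> u0 + Ialpha (f (., u))] halves distances ([contraction_radius]).
The iterates started at the constant [u0] converge to a solution. Any two
solutions on a common ball differ by a bounded amount, since [f] is bounded; the
difference is at most half of itself, hence it is [0].

The origin needs care, since nothing is known about [f 0]. All functions that
occur take the value [u0] there, so [f 0 u0] is the only value that enters: it
is one more constant in the bound for [f], and it cancels in differences. *)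

Set Implicit Arguments.
Unset Strict Implicit.
Unset Printing Implicit Defensive.

Import Order.TTheory GRing.Theory Num.Theory.
Import numFieldNormedType.Exports.

Local Open Scope classical_set_scope.
Local Open Scope ring_scope.

(** * The value group of the absolute value *)

Lemma exp_lt_eps (R : realType) (z e : R) :
  0 < z < 1 -> 0 < e -> exists n, z ^+ n < e.
Proof.
move=> /andP[z0 z1] e0.
have : z ^+ n @[n --> \oo] --> (0 : R) by apply: cvg_expr; rewrite gtr0_norm.
move/cvgrPdist_lt => /(_ e e0)[n _ /(_ n (leqnn n))].
by rewrite /= sub0r normrN ger0_norm ?exprn_ge0 ?ltW//; exists n.
Qed.

Section NormalizedAbsoluteValue.
Variables (R : realType) (K : topologicalFieldType) (q : nat) (abs : K -> R).
Hypothesis habs : normalized_abs abs q.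

Lemma abs0 : abs 0 = 0.
Proof. exact/(abs_eq0 habs). Qed.

Lemma abs_gt0 x : x != 0 -> 0 < abs x.
Proof.
move=> x0; rewrite lt_neqAle (abs_ge0 habs) andbT eq_sym.
by apply: contra_neq x0 => /(abs_eq0 habs).
Qed.

Lemma abs1 : abs 1 = 1.
Proof.
have a1 : abs 1 != 0 by rewrite gt_eqF// abs_gt0 ?oner_eq0.
by apply: (mulfI a1); rewrite -(abs_mul habs) !mulr1.
Qed.

Lemma absN x : abs (- x) = abs x.
Proof.
have absN1 : abs (-1) = 1.
  apply/eqP; rewrite -(@eqrXn2 _ 2%N) ?(abs_ge0 habs)// expr1n expr2.
  by rewrite -(abs_mul habs) mulrNN mulr1 abs1.
by rewrite -mulN1r (abs_mul habs) absN1 mul1r.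
Qed.

Lemma absB x y : abs (x - y) = abs (y - x).
Proof. by rewrite -absN opprB. Qed.

Lemma absV x : abs x^-1 = (abs x)^-1.
Proof.
have [->|x0] := eqVneq x 0; first by rewrite invr0 abs0 invr0.
have ax : abs x != 0 by rewrite gt_eqF// abs_gt0.
by apply: (mulfI ax); rewrite -(abs_mul habs) !mulfV// abs1.
Qed.

Lemma absX x n : abs (x ^+ n) = abs x ^+ n.
Proof.
elim: n => [|n IH]; first by rewrite !expr0 abs1.
by rewrite !exprS (abs_mul habs) IH.
Qed.

Lemma abs_le_add x y r : abs x <= r -> abs y <= r -> abs (x + y) <= r.
Proof.
move=> xr yr; apply: le_trans (abs_ultrametric habs x y) _.
by rewrite ge_max xr.
Qed.

(** If [abs (x - y)] were smaller than [abs x], the ultrametric inequality for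
[x = (x - y) + y] would bound [abs x] by something strictly smaller. *)
Lemma abs_sub_dominant x y : abs y < abs x -> abs (x - y) = abs x.
Proof.
move=> yx; apply/le_anti/andP; split.
  by rewrite abs_le_add ?absN// ltW.
rewrite leNgt; apply/negP => xyx; have := abs_ultrametric habs (x - y) y.
by rewrite subrK leNgt gt_max xyx yx.
Qed.

(** Two integers lie in different residue classes exactly when their distance is
at least [1]. The classes of [0] and [1] differ, which excludes [q <= 1]. *)
Lemma residue_representatives : (1 < q)%N /\ exists a : nat -> K,
  (forall i, (i < q)%N -> abs (a i) <= 1) /\
  (forall i j, (i < q)%N -> (j < q)%N -> i <> j -> 1 <= abs (a i - a j)).
Proof.
have /card_esym/card_set_bijP[c [cfun cinj csurj]] := abs_residue habs.
have cosetE (x y : K) : abs (x - y) < 1 ->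
    [set x + p | p in maximal_ideal abs] `<=`
    [set y + p | p in maximal_ideal abs].
  move=> xy _ [p p1 <-]; exists (x - y + p); last first.
    by rewrite addrA [y + _]addrC subrK.
  by rewrite /maximal_ideal/=; apply: le_lt_trans (abs_ultrametric habs _ _) _;
    rewrite gt_max xy.
have mem_coset (x : K) : [set x + p | p in maximal_ideal abs] x.
  by exists 0; rewrite ?addr0// /maximal_ideal/= abs0.
split.
  have [|i iq ci] := csurj [set 0 + p | p in maximal_ideal abs].
    by exists 0 => //; rewrite /integer_ring/= abs0.
  have [|j jq cj] := csurj [set 1 + p | p in maximal_ideal abs].
    by exists 1 => //; rewrite /integer_ring/= abs1.
  have /eqP ij : i <> j.
    move=> ij; have := mem_coset 1; rewrite -cj -ij ci => -[p].
    by rewrite /maximal_ideal/= add0r => + p1; rewrite p1 abs1 ltxx.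
  rewrite /= in iq jq; case: q iq jq => [//|[|//]].
  by rewrite !ltnS !leqn0 => /eqP i0 /eqP j0; rewrite i0 j0 eqxx in ij.
have rep i : exists x, (i < q)%N ->
    abs x <= 1 /\ c i = [set x + p | p in maximal_ideal abs].
  have [iq|iq] := pselect (i < q)%N; last by exists 0.
  by have [x x1 xc] := cfun i iq; exists x.
have [a aP] := choice rep.
exists a; split=> [i /aP[]//|i j iq jq ij].
rewrite leNgt; apply/negP => aij; apply: ij.
apply: cinj; rewrite ?inE//.
rewrite (aP _ iq).2 (aP _ jq).2; apply/seteqP; split; apply: cosetE => //.
by rewrite absB.
Qed.

Lemma q_gt1 : (1 < q)%N. Proof. by case: residue_representatives. Qed.


Lemma invq_gt0 : 0 < q%:R^-1 :> R.
Proof. by rewrite invr_gt0 ltr0n (ltn_trans _ q_gt1). Qed.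

Lemma invq_lt1 : q%:R^-1 < 1 :> R.
Proof. by rewrite invf_lt1 ?ltr1n ?q_gt1// ltr0n (ltn_trans _ q_gt1). Qed.

(** The maximal ideal is generated by an element of absolute value [q^-1], so
anything of absolute value less than [1] is that generator times an integer;
repeating the division must stop, as each step multiplies [abs x] by [q]. *)
Lemma abs_power x : x != 0 -> abs x <= 1 -> exists n, abs x = q%:R^-1 ^+ n.
Proof.
move=> x0 x1; have [|m] := @exp_lt_eps R q%:R^-1 _ _ (abs_gt0 x0).
  by rewrite invq_gt0 invq_lt1.
elim: m x x0 x1 => [|m IH] x x0 x1; first by rewrite expr0 ltNge x1.
move=> mx; case: (abs_uniformizer habs) => b bE ab.
have [x1'|x1'] := ltP (abs x) 1; last first.
  by exists 0%N; rewrite expr0; apply/le_anti; rewrite x1 x1'.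
have : maximal_ideal abs x by [].
rewrite bE => -[y y1 bxy].
have [||| n yn] := IH y.
- by apply: contra_neq x0 => y0; rewrite -bxy y0 mulr0.
- by [].
- move: mx; rewrite -bxy (abs_mul habs) ab exprS ltr_pM2l//.
  exact: invq_gt0.
- by exists n.+1; rewrite -bxy (abs_mul habs) ab yn exprS.
Qed.

(** Countability of the value set makes every radial function measurable, with
no assumption on the underlying function of a real variable. *)
Lemma abs_countable : countable (range abs).
Proof.
(* [None] encodes the value 0, the boolean the sign of the exponent. *)
pose h (z : option (bool * nat)) : R := match z with
  | None => 0
  | Some (b, n) => if b then q%:R^-1 ^+ n else (q%:R^-1 ^+ n)^-1
  end.
apply: (@sub_countable _ _ _ (range h)); last first.
  exact: card_le_trans (card_image_le _ _) (countableP _).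
apply: subset_card_le => _ [x _ <-].
have [->|x0] := eqVneq x 0; first by exists None; rewrite //= abs0.
have [x1|x1] := leP (abs x) 1.
  by have [n ->] := abs_power x0 x1; exists (Some (true, n)).
have [|| n xn] := @abs_power x^-1; first by rewrite invr_eq0.
  by rewrite absV invf_le1 ?abs_gt0// ltW.
by exists (Some (false, n)) => //=; rewrite -xn absV invrK.
Qed.

End NormalizedAbsoluteValue.

(** * Borel measurability of radial functions *)

Section BorelStructure.
Variables (R : realType) (K : topologicalFieldType) (q : nat) (abs : K -> R).
Hypothesis habs : normalized_abs abs q.

Lemma open_abs_lt r : open [set x : K | abs x < r].
Proof.
rewrite openE => x /= xr; apply/(abs_topology habs).
have r0 : 0 < r by apply: le_lt_trans xr; apply: (abs_ge0 habs).
exists r => // y /= yxr; rewrite -(subrK x y).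
by apply: le_lt_trans (abs_ultrametric habs _ _) _; rewrite gt_max yxr.
Qed.

Lemma measurable_abs : measurable_fun [set: borel K] (abs : borel K -> R).
Proof.
apply: (measurability _ (RGenCInfty.measurableE R)) => // _ [_ [r ->] <-].
rewrite setTI (_ : _ @^-1` _ = ~` [set x : K | abs x < r]).
  apply: measurableC; apply: sub_sigma_algebra; exact: open_abs_lt.
by apply/seteqP; split => x /=; rewrite in_itv/= andbT leNgt => /negP.
Qed.

(** The function [v] is arbitrary: only the countably many values of [abs]
matter, and a countable set of reals is Borel. *)
Lemma measurable_radial (v : R -> R) (D : set (borel K)) :
  measurable_fun D (fun y : borel K => v (abs y)).
Proof.
apply: measurable_funTS => _ B mB; rewrite setTI.
rewrite (_ : _ @^-1` _ = abs @^-1` (range abs `&` v @^-1` B)); last first.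
  by apply/seteqP; split => [x vx|x []//]; split => //; exists x.
rewrite -[X in measurable X]setTI; apply: measurable_abs => //.
apply: countable_measurable; first by move=> t; exact: measurable_set1.
apply: sub_countable (abs_countable habs).
by apply: subset_card_le; exact: subIsetl.
Qed.

Lemma measurable_abs_le r : measurable [set y : borel K | abs y <= r].
Proof.
rewrite (_ : mkset _ = abs @^-1` [set` `]-oo, r]]).
  by rewrite -[X in measurable X]setTI; apply: measurable_abs.
by apply/seteqP; split => x; rewrite /= in_itv.
Qed.

Lemma measurable_abs_eq r : measurable [set y : borel K | abs y = r].
Proof.
rewrite (_ : mkset _ = abs @^-1` [set r])//.
by rewrite -[X in measurable X]setTI; apply: measurable_abs.
Qed.

Lemma measurable_shift (x : K) :
  measurable_fun [set: borel K] ((fun y => y - x) : borel K -> borel K).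
Proof.
apply: (@measurability _ _ (borel K) (borel K) setT _ (@open K)) => //.
move=> _ [B oB <-].
rewrite setTI; apply: sub_sigma_algebra.
have : continuous (fun y : K => y - x).
  move=> y; apply: (@continuous_comp K (K * K)%type K
    (fun y => (y, x)) (fun z => z.1 - z.2)); last exact: sub_continuous.
  by apply: cvg_pair; [exact: cvg_id|exact: cvg_cst].
by move/continuousP; apply.
Qed.
End BorelStructure.

(** * Haar measure of balls *)

Section HaarMeasure.
Variables (R : realType) (K : topologicalFieldType) (q : nat) (abs : K -> R)
  (mu : {measure set (borel K) -> \bar R}).
Hypotheses (habs : normalized_abs abs q) (hmu : normalized_haar abs mu).

Lemma shift_preimage (x : K) (A : set (borel K)) :
  [set x + a | a in (A : set K)] = (fun y : K => y - x) @^-1` A.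
Proof.
apply/seteqP; split => [_ [a Aa <-]|y Ay] /=.
  by rewrite addrAC subrr add0r.
by exists (y - x) => //; rewrite addrCA subrr addr0.
Qed.

Lemma measurable_translate (x : K) (A : set (borel K)) : measurable A ->
  measurable ([set x + a | a in (A : set K)] : set (borel K)).
Proof.
move=> mA; rewrite shift_preimage -[X in measurable X]setTI.
exact: measurable_shift.
Qed.

(** With [b] a uniformizer and [a i] representatives of the residue classes, the
[q] translates of the ball of radius [q ^ - (n + 1)] by [b ^+ n * a i] are
disjoint and contained in the ball of radius [q ^ - n]. *)
Lemma haar_ball n :
  (mu [set y : borel K | (abs y <= q%:R^-1 ^+ n)%R] <= (q%:R^-1 ^+ n)%:E)%E.
Proof.
have q0 : 0 < q%:R :> R by rewrite ltr0n (ltn_trans _ (q_gt1 habs)).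
elim: n => [|n IH]; first by rewrite expr0 (haar_integer_ring hmu).
have [_ [a [a1 asep]]] := residue_representatives habs.
case: (abs_uniformizer habs) => b _ ab.
pose B n := [set y : borel K | abs y <= q%:R^-1 ^+ n].
pose F (i : 'I_q) : set (borel K) :=
  [set b ^+ n * a i + y | y in (B n.+1 : set K)].
have mF i : measurable (F i).
  by apply: measurable_translate; apply: measurable_abs_le habs _.
have pn m : 0 < q%:R^-1 ^+ m :> R by rewrite exprn_gt0// (invq_gt0 habs).
have tF : trivIset [set: 'I_q] F.
  apply/trivIsetP => i j _ _ ij; apply/seteqP; split => // y [[z zB <-] [w wB]].
  move=> wz; have E : b ^+ n * (a j - a i) = z - w.
    by rewrite mulrBr; apply/eqP; rewrite subr_eq addrAC [z + _]addrC -wz addrK.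
  have : abs (b ^+ n * (a j - a i)) <= q%:R^-1 ^+ n.+1.
    rewrite E; apply: (abs_le_add habs) => //.
    by rewrite (absN habs).
  rewrite (abs_mul habs) (absX habs) ab exprS leNgt => /negP; apply.
  rewrite mulrC ltr_pM2l//; apply: lt_le_trans (invq_lt1 habs) _.
  by apply: asep => //; move/val_inj => ji; rewrite ji eqxx in ij.
have sub : (\sum_(i < q) mu (F i) <= mu (B n))%E.
  rewrite -measure_bigsetU_ord//; apply: le_measure; rewrite ?inE.
  - by apply: bigsetU_measurable => i _; exact: mF.
  - exact: measurable_abs_le habs _.
  - apply: (big_ind (fun A => A `<=` B n)) => [//|A1 A2 A1B A2B|i _].
      by rewrite subUset.
    move=> _ [z zB <-]; apply: (abs_le_add habs).
    + by rewrite (abs_mul habs) (absX habs) ab ger_pMr// a1.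
    + by apply: le_trans zB _; rewrite exprS ger_pMl// ltW// (invq_lt1 habs).
have muF i : mu (F i) = mu (B n.+1).
  by apply: (haar_translation hmu); apply: measurable_abs_le habs _.
have := le_trans sub IH; rewrite (eq_bigr _ (fun i _ => muF i)).
rewrite big_const_ord => qB.
rewrite [X in (_ <= X%:E)%E]exprS EFinM lee_pdivlMl//.
by rewrite mule_natl /enatmul Monoid.iteropE.
Qed.

End HaarMeasure.

(** * Integrals over balls centred at the origin *)

Section BallIntegrals.
Variables (R : realType) (K : topologicalFieldType) (q : nat) (abs : K -> R)
  (mu : {measure set (borel K) -> \bar R}).
Hypotheses (habs : normalized_abs abs q) (hmu : normalized_haar abs mu).

Local Notation cball r := [set y : borel K | (abs y <= r)%R].

(** In an ultrametric space a ball is centred at each of its points. *)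
Lemma shift_cball (x : K) r : abs x <= r ->
  ((fun y : K => y - x) : borel K -> borel K) @^-1` cball r = cball r.
Proof.
move=> xr; apply/seteqP; split => y /= yr.
  by rewrite -(subrK x y); exact: (abs_le_add habs).
by apply: (abs_le_add habs) => //; rewrite (absN habs).
Qed.

(** Change of variables [y |-> y - x]: it preserves both the Haar measure and a
ball that contains [x]. *)
Lemma integrable_shift (G : borel K -> R) (x : K) r : abs x <= r ->
  measurable_fun [set: borel K] G -> mu.-integrable (cball r) (EFin \o G) ->
  mu.-integrable (cball r) (EFin \o (fun y => G ((y : K) - x))) /\
  \int[mu]_(y in cball r) G ((y : K) - x) = \int[mu]_(y in cball r) G y.
Proof.
move=> xr mG iG.
pose s : borel K -> borel K := fun y : K => y - x.
have ms : measurable_fun [set: borel K] s by exact: measurable_shift.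
have mB : measurable (cball r) by apply: measurable_abs_le habs _.
(* [pushforward mu s A] is the measure of the translate of [A] by [x]. *)
have muE A : measurable A -> A `<=` cball r -> mu A = pushforward mu s A.
  by move=> mA _; rewrite /pushforward -shift_preimage (haar_translation hmu).
have msB : s @^-1` cball r = cball r by exact: shift_cball.
have iGs : mu.-integrable (cball r) (EFin \o (G \o s)).
  apply/integrableP; split.
    by apply/measurable_EFinP; apply: measurable_funTS; exact: measurableT_comp.
  case/integrableP: iG => mGB; apply: le_lt_trans.
  rewrite [leRHS](eq_measure_integral (pushforward mu s) muE).
  rewrite [leRHS](ge0_integral_pushforward ms) ?msB//.
  by apply: measurableT_comp => //; apply: measurableT_comp => //.
split => //; rewrite /Rintegral; congr fine.
rewrite [RHS](eq_measure_integral (pushforward mu s) muE).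
rewrite [RHS](integral_pushforward ms)// ?msB//.
exact/measurable_EFinP.
Qed.

Section PowerBound.
Variables (g : R -> R) (C d : R).
Hypotheses (d0 : 0 < d) (C0 : 0 <= C) (g0 : g 0 = 0)
  (gC : forall r, 0 < r <= 1 -> `|g r| <= C * r `^ (d - 1)).

Lemma powR_invq_lt1 : 0 < q%:R^-1 `^ d < 1.
Proof.
rewrite powR_gt0 ?(invq_gt0 habs)//=.
have := gt0_ltr_powR d0; move=> /(_ q%:R^-1 1); rewrite powR1; apply.
- by rewrite nnegrE ltW// (invq_gt0 habs).
- by rewrite nnegrE.
- exact: invq_lt1 habs.
Qed.

(** On the sphere of radius [r = abs x * q ^ - i] the integrand is at most
[C * r `^ (d - 1)], and the measure of that sphere is at most [r]; the terms
[C * r `^ d] form a geometric series of ratio [q^-1 `^ d]. Since [g 0 = 0], the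
origin can be left out of the ball. *)
Lemma integral_radial_le (x : K) : x != 0 -> abs x <= 1 ->
  (\int[mu]_(y in cball (abs x)) `|g (abs y)|%:E <=
   (C / (1 - q%:R^-1 `^ d) * abs x `^ d)%:E)%E.
Proof.
move=> x0 x1; have [m xm] := abs_power habs x0 x1.
set p : R := q%:R^-1 in xm *.
have p0 : 0 < p by exact: invq_gt0 habs.
have p1 : p < 1 by exact: invq_lt1 habs.
have /andP[pd0 pd1] := powR_invq_lt1.
have pn n : 0 < p ^+ n by rewrite exprn_gt0.
have pX n : (p ^+ n) `^ d = (p `^ d) ^+ n.
  by rewrite -!powR_mulrn ?powR_ge0 ?ltW// -!powRrM mulrC.
pose F i : set (borel K) := [set y | abs y = p ^+ (m + i)].
have mF i : measurable (F i) by apply: measurable_abs_eq habs _.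
have mh D : measurable_fun D (fun y : borel K => `|g (abs y)|%:E).
  by apply/measurable_EFinP; apply: (measurable_radial habs (fun r => `|g r|)).
have -> : (\int[mu]_(y in cball (abs x)) `|g (abs y)|%:E =
    \int[mu]_(y in \bigcup_i F i) `|g (abs y)|%:E)%E.
  rewrite integral_mkcond [RHS]integral_mkcond; congr integral.
  apply/funext => y; rewrite !patchE.
  have [/set_mem/= yx|yx] := boolP (y \in cball _);
    have [/set_mem yF|/negP yF] := boolP (y \in \bigcup_i F i) => //.
    have [->|y0] := eqVneq y 0; first by rewrite (abs0 habs) g0 normr0.
    have [n yn] := abs_power habs y0 (le_trans yx x1).
    exfalso; apply/yF/mem_set; exists (n - m)%N => //=.
    rewrite /F/= subnKC// leqNgt; apply/negP => nm.
    by move: yx; rewrite leNgt yn xm ltr_iXn2l ?nm.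
  case: yF => i _ yi; exfalso; move/negP: yx; apply; apply/mem_set.
  by rewrite /= yi xm ler_iXn2l ?leq_addr.
rewrite ge0_integral_bigcup//; last first.
  apply/trivIsetP => i j _ _ ij; apply/seteqP; split => // y [/= yi].
  rewrite /F/= yi.
  by move/(ieexprIn p0 (negbT (lt_eqF p1)))/addnI => ji; rewrite ji eqxx in ij.
have Fle i : (\int[mu]_(y in F i) `|g (abs y)|%:E <=
    (geometric (C * abs x `^ d) (p `^ d) i)%:E)%E.
  rewrite (eq_integral (cst (`|g (p ^+ (m + i))|%:E))).
    rewrite integral_cst//.
    have muF : (mu (F i) <= (p ^+ (m + i))%:E)%E.
      apply: le_trans (haar_ball habs hmu _); apply: le_measure; rewrite ?inE//.
        by apply: measurable_abs_le habs _.
      by rewrite /F => y /= ->.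
    apply: (le_trans (lee_pmul _ _ (lexx _) muF)) => //.
    rewrite -EFinM lee_fin /=.
    apply: le_trans (ler_wpM2r (ltW (pn _)) (gC _)) _.
      by rewrite pn exprn_ile1// ltW.
    by rewrite -[leLHS]mulrA [_ `^ _ * _]mulrC mulr_powRB1 ?(ltW (pn _))//
      xm !pX exprD mulrA.
  by move=> y /set_mem; rewrite /F /= => ->.
apply: (le_trans (lee_nneseries _ (fun i _ => Fle i))).
  by move=> i _ _; apply: integral_ge0.
apply: lime_le.
  apply: is_cvg_nneseries => i _ _.
  by rewrite lee_fin !mulr_ge0 ?exprn_ge0 ?powR_ge0.
apply: nearW => n; rewrite sumEFin lee_fin.
have -> : C / (1 - p `^ d) * abs x `^ d = (C * abs x `^ d) / (1 - p `^ d).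
  by rewrite mulrAC.
by apply: geometric_le_lim; rewrite ?mulr_ge0 ?powR_ge0 ?gtr0_norm.
Qed.

End PowerBound.
End BallIntegrals.

(** * The kernel and the operator on bounded radial functions *)

(** The radial function [g] such that the kernel is [g |x - y| - g |y|]; it
covers the logarithmic and the power case at once. *)
Definition riesz_profile (R : realType) (alpha r : R) : R :=
  if alpha == 1 then ln r else r `^ (alpha - 1).

Lemma riesz_profile0 (R : realType) (alpha : R) : riesz_profile alpha 0 = 0.
Proof.
rewrite /riesz_profile; case: ifPn => [_|a1]; first by rewrite ln0.
by rewrite powR0// subr_eq0.
Qed.

(** For a power, [d = alpha] works. For the logarithm any [d] in the open unit
interval does, because [ln] grows more slowly than every power; the bound below
is [ln t < t] at [t = r `^ (- 1 / 2)], which gives [d = 1 / 2]. *)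
Lemma riesz_profile_bound (R : realType) (alpha : R) : 0 < alpha ->
  exists C d : R, [/\ 0 <= C, 0 < d & forall r, 0 < r <= 1 ->
    `|riesz_profile alpha r| <= C * r `^ (d - 1)].
Proof.
move=> a0; rewrite /riesz_profile; have [_|a1] := eqVneq alpha 1; last first.
  by exists 1, alpha; split => // r _; rewrite mul1r ger0_norm ?powR_ge0.
exists 2, 2^-1; split => // r /andP[r0 r1].
have -> : 2^-1 - 1 = - 2^-1 :> R by lra.
have := @ln_sublinear _ (r `^ (- 2^-1)); rewrite powR_gt0// => /(_ isT).
rewrite ln_powR mulNr -mulrN => lr.
rewrite ler0_norm ?ln_le0//; lra.
Qed.

Section RieszOperator.
Variables (R : realType) (K : topologicalFieldType) (q : nat) (abs : K -> R)
  (mu : {measure set (borel K) -> \bar R}).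
Hypotheses (habs : normalized_abs abs q) (hmu : normalized_haar abs mu).
Variables (alpha C d : R).
Local Notation g := (riesz_profile alpha).
Hypotheses (d0 : 0 < d) (C0 : 0 <= C)
  (gC : forall r, 0 < r <= 1 -> `|g r| <= C * r `^ (d - 1)).

Local Notation cball r := [set y : borel K | (abs y <= r)%R].

(** The sum of the geometric series of [integral_radial_le]. *)
Definition profile_bound (x : K) : R := C / (1 - q%:R^-1 `^ d) * abs x `^ d.

Lemma Ialpha_kernelE (x y : K) :
  Ialpha_kernel abs alpha x y = g (abs (y - x)) - g (abs y).
Proof. by rewrite /Ialpha_kernel /riesz_profile (absB habs); case: ifP. Qed.

Lemma measurable_cball r : measurable (cball r).
Proof. exact: measurable_abs_le habs _. Qed.
Local Hint Resolve measurable_cball : core.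

Section KernelAt.
Variable x : K.
Hypotheses (x0 : x != 0) (x1 : abs x <= 1).
Local Notation B := (cball (abs x)).
Local Notation kernel := (fun y : borel K => Ialpha_kernel abs alpha x y).

Lemma profile_integrable :
  mu.-integrable B (EFin \o (fun y : borel K => g (abs y))) /\
  \int[mu]_(y in B) `|g (abs y)| <= profile_bound x.
Proof.
have le := integral_radial_le habs hmu d0 C0 (riesz_profile0 alpha) gC x0 x1.
have ig : mu.-integrable B (EFin \o (fun y : borel K => g (abs y))).
  apply/integrableP; split; last by apply: le_lt_trans le _; rewrite ltry.
  apply/measurable_EFinP.
  exact: (measurable_radial habs (riesz_profile alpha)).
split => //; rewrite /Rintegral -lee_fin fineK//.
by apply: integrable_fin_num => //; exact: integrable_norm.
Qed.

Lemma shifted_profile_integrable :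
  mu.-integrable B (EFin \o (fun y : borel K => g (abs ((y : K) - x)))) /\
  \int[mu]_(y in B) g (abs ((y : K) - x)) = \int[mu]_(y in B) g (abs y).
Proof.
have [ig _] := profile_integrable.
apply: (integrable_shift habs hmu (G := fun y => g (abs y))) => //.
exact: (measurable_radial habs (riesz_profile alpha)).
Qed.

Lemma shifted_profile_norm :
  \int[mu]_(y in B) `|g (abs ((y : K) - x))| = \int[mu]_(y in B) `|g (abs y)|.
Proof.
have [ig _] := profile_integrable.
apply: (integrable_shift habs hmu (G := fun y => `|g (abs y)|) _ _ _).2 => //.
  exact: (measurable_radial habs (fun r => `|g r|)).
exact: integrable_norm.
Qed.

Lemma kernel_integrable : mu.-integrable B (EFin \o kernel).
Proof.
have [ig _] := profile_integrable; have [isg _] := shifted_profile_integrable.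
have := integrableB (measurable_cball _) isg ig.
by apply: eq_integrable => // y _; rewrite /= Ialpha_kernelE.
Qed.

(** The two halves of the kernel are translates of each other, and the
translation preserves the ball. *)
Lemma kernel_integral0 : \int[mu]_(y in B) kernel y = 0.
Proof.
have [ig _] := profile_integrable; have [isg E] := shifted_profile_integrable.
under eq_Rintegral do rewrite Ialpha_kernelE.
by rewrite RintegralB// E subrr.
Qed.

Lemma kernel_norm_integral :
  \int[mu]_(y in B) `|kernel y| <= 2 * profile_bound x.
Proof.
have [ig gle] := profile_integrable; have [isg _] := shifted_profile_integrable.
have ing := integrable_norm ig; have insg := integrable_norm isg.
apply: (@le_trans _ _ (\int[mu]_(y in B)
    (`|g (abs ((y : K) - x))| + `|g (abs y)|))).
  apply: le_Rintegral => //.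
  - exact: integrable_norm kernel_integrable.
  - have := integrableD (measurable_cball _) insg ing.
    by apply: eq_integrable => // y _; rewrite /= EFinD.
  - by move=> y _; rewrite Ialpha_kernelE ler_normB.
by rewrite RintegralD// shifted_profile_norm mulr2n mulrDl mul1r lerD.
Qed.

Section RadialArgument.
Variables (v : R -> R) (A : R).
Hypothesis vA : forall y : K, abs y <= abs x -> `|v (abs y)| <= A.
Local Notation phi := (fun y : K => v (abs y)).

Lemma kernel_radial_integrable :
  mu.-integrable B (EFin \o (fun y => kernel y * phi y)).
Proof.
apply: (@integrableMl _ _ _ mu B (measurable_cball _) (EFin \o kernel) phi).
- exact: kernel_integrable.
- exact: (measurable_radial habs v).
- exists A; split; first by rewrite num_real.
  by move=> A' AA' y /= yx; apply: le_trans (vA yx) (ltW AA').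
Qed.

Lemma Ialpha_exists_radial : Ialpha_exists abs mu alpha phi x.
Proof. by move=> _; exact: kernel_radial_integrable. Qed.

Lemma Ialpha_le :
  `|Ialpha q abs mu alpha phi x| <=
  `|Ialpha_const q alpha| * (2 * profile_bound x * A).
Proof.
rewrite /Ialpha (negbTE x0) normrM ler_wpM2l//.
apply: le_trans (le_normr_Rintegral _ kernel_radial_integrable) _ => //.
have ik := kernel_integrable.
have A0 : 0 <= A by apply: le_trans (vA (lexx _)).
apply: (@le_trans _ _ (\int[mu]_(y in B) (A * `|kernel y|))).
  apply: le_Rintegral => //.
  - exact: integrable_norm kernel_radial_integrable.
  - have := integrableZl (measurable_cball _) A (integrable_norm ik).
    by apply: eq_integrable => // y _; rewrite /= EFinM.
  - by move=> y yx; rewrite normrM mulrC ler_wpM2r// vA.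
rewrite RintegralZl//; last exact: integrable_norm.
by rewrite mulrC ler_wpM2r// kernel_norm_integral.
Qed.

(** Subtracting the constant [v (abs x)] costs nothing because the kernel has
integral [0]. It removes the sphere [abs y = abs x], the only place where
[abs (x - y)] is not determined by [abs x] and [abs y]. *)
Lemma Ialpha_radialE : Ialpha q abs mu alpha phi x = Ialpha_const q alpha *
  \int[mu]_(y in B) ((g (abs x) - g (abs y)) * (v (abs y) - v (abs x))).
Proof.
rewrite /Ialpha (negbTE x0); congr (_ * _).
have ik := kernel_integrable.
transitivity (\int[mu]_(y in B) (kernel y * phi y - v (abs x) * kernel y)).
  rewrite RintegralB//; [|exact: kernel_radial_integrable|]; last first.
    have := integrableZl (measurable_cball _) (v (abs x)) ik.
    by apply: eq_integrable => // y _; rewrite /= EFinM.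
  by rewrite RintegralZl// kernel_integral0 mulr0 subr0.
apply: eq_Rintegral => y /set_mem/= yx.
rewrite [v _ * _]mulrC -mulrBr.
have [->|yx'] := eqVneq (abs y) (abs x); first by rewrite !subrr !mulr0.
rewrite Ialpha_kernelE (absB habs) (abs_sub_dominant habs)//.
by rewrite lt_neqAle yx'.
Qed.

End RadialArgument.
End KernelAt.

(** Read off from [Ialpha_radialE], whose right-hand side depends on [abs x]
only. *)
Lemma Ialpha_radial (v : R -> R) (A : R) (x x' : K) :
  abs x = abs x' -> abs x <= 1 ->
  (forall y : K, abs y <= abs x -> `|v (abs y)| <= A) ->
  Ialpha q abs mu alpha (fun y => v (abs y)) x =
  Ialpha q abs mu alpha (fun y => v (abs y)) x'.
Proof.
move=> xx' x1 vA; have [xz|x0] := eqVneq x 0.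
  have -> : x' = 0 by apply/(abs_eq0 habs); rewrite -xx' xz (abs0 habs).
  by rewrite xz.
have x'0 : x' != 0.
  apply: contra_neq x0 => x'0; apply/(abs_eq0 habs).
  by rewrite xx' x'0 (abs0 habs).
by rewrite !(@Ialpha_radialE _ _ _ v A) -?xx'.
Qed.

Lemma Ialpha_sub (v w : R -> R) (A A' : R) (x : K) : abs x <= 1 ->
  (forall y : K, abs y <= abs x -> `|v (abs y)| <= A) ->
  (forall y : K, abs y <= abs x -> `|w (abs y)| <= A') ->
  Ialpha q abs mu alpha (fun y => v (abs y)) x -
  Ialpha q abs mu alpha (fun y => w (abs y)) x =
  Ialpha q abs mu alpha (fun y => v (abs y) - w (abs y)) x.
Proof.
move=> x1 vA wA; rewrite /Ialpha; case: eqVneq => x0; first by rewrite subrr.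
rewrite -mulrBr -RintegralB//; last 2 first.
- exact: (kernel_radial_integrable x0 x1 vA).
- exact: (kernel_radial_integrable x0 x1 wA).
by congr (_ * _); apply: eq_Rintegral => y _; rewrite mulrBr.
Qed.

End RieszOperator.

(** * Picard iteration *)

(** The form in which a contraction by one half is used: it bounds the distance
of two solutions, and the defect of the limit of the iterates, in this way. *)
Lemma le_halves_eq0 (R : realType) (c x : R) :
  (forall n, `|x| <= c * 2^-1 ^+ n) -> x = 0.
Proof.
move=> xc; apply/eqP; rewrite -normr_le0 leNgt; apply/negP => x0.
have c0 : 0 < c by have := xc 0%N; rewrite expr0 mulr1; exact: lt_le_trans.
have [| |n] := @exp_lt_eps R 2^-1 (`|x| / c); [lra|exact: divr_gt0|].
by rewrite ltr_pdivlMr// mulrC ltNge xc.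
Qed.

(** The sequences [a n - e n] and [a n + e n], with [e n] the sum of all
remaining steps, are monotone and enclose the limit. This gives the rate of
convergence together with the limit. *)
Lemma halving_steps_limit (R : realType) (a : nat -> R) (B : R) :
  (forall n, `|a n.+1 - a n| <= B * 2^-1 ^+ n) ->
  exists l, forall n, `|l - a n| <= 2 * B * 2^-1 ^+ n.
Proof.
move=> aB; pose e n : R := 2 * B * 2^-1 ^+ n.
have step n : a n - e n <= a n.+1 - e n.+1 /\ a n.+1 + e n.+1 <= a n + e n.
  have := aB n; rewrite ler_norml /e exprS => /andP[]; set z := _ ^+ n; lra.
have e0 n : 0 <= e n.
  rewrite /e -mulrA mulr_ge0//; exact: le_trans (aB n).
have lo n m : (n <= m)%N -> a n - e n <= a m - e m.
  suff /nondecreasing_seqP : forall k, a k - e k <= a k.+1 - e k.+1 by apply.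
  by move=> k; exact: (step k).1.
have up n m : (n <= m)%N -> a m + e m <= a n + e n.
  suff /nonincreasing_seqP : forall k, a k.+1 + e k.+1 <= a k + e k by apply.
  by move=> k; exact: (step k).2.
have loup n m : a n - e n <= a m + e m.
  apply: (le_trans (lo _ _ (leq_maxl n m))).
  apply: (le_trans _ (up _ _ (leq_maxr n m))).
  by have := e0 (maxn n m); lra.
pose S := range (fun n => a n - e n); exists (sup S) => n.
have S0 : S !=set0 by exists (a 0%N - e 0%N), 0%N.
have Sub m : ubound S (a m + e m) by move=> _ [k _ <-].
rewrite ler_distl; apply/andP; split; last exact: ge_sup.
by apply: ub_le_sup; [exists (a 0%N + e 0%N)|exists n].
Qed.

Section MildSolutions.
Variables (R : realType) (K : topologicalFieldType) (q : nat) (abs : K -> R)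
  (mu : {measure set (borel K) -> \bar R}) (alpha u0 M F : R) (f : R -> R -> R).
Hypotheses (habs : normalized_abs abs q) (hmu : normalized_haar abs mu)
  (alpha0 : 0 < alpha) (F0 : 0 < F)
  (fM : forall (t : K) (x : R), t != 0 -> `|f (abs t) x| <= M)
  (fF : forall (t : K) (x y : R), t != 0 ->
     `|f (abs t) x - f (abs t) y| <= F * `|x - y|).

Local Notation I v := (Ialpha q abs mu alpha (fun y : K => v (abs y))).

(** The factor [abs x `^ d] in the bound for [Ialpha] tends to [0] with [abs x],
whatever the other constants are. *)
Lemma Ialpha_small (eps : R) : 0 < eps -> exists N : nat,
  forall (v : R -> R) (A : R) (x : K), abs x <= q%:R^-1 ^+ N ->
    (forall y, abs y <= abs x -> `|v (abs y)| <= A) -> `|I v x| <= eps * A.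
Proof.
move=> eps0; have [C [d [C0 d0 gC]]] := riesz_profile_bound alpha0.
have pd := powR_invq_lt1 habs d0; have /andP[pd0 pd1] := pd.
set p : R := q%:R^-1 in pd pd0 pd1 *.
have p0 : 0 < p by exact: invq_gt0 habs.
pose k := `|Ialpha_const q alpha : R| * (2 * (C / (1 - p `^ d))).
have k0 : 0 <= k by rewrite !mulr_ge0// invr_ge0 subr_ge0 ltW.
have [|N pN] := @exp_lt_eps R (p `^ d) (eps / (k + 1)) pd.
  by rewrite divr_gt0// ltr_pwDr.
exists N => v A x xN vA.
have A0 : 0 <= A by apply: le_trans (vA x (lexx _)).
have [->|x0] := eqVneq x 0; first by rewrite /Ialpha eqxx normr0 mulr_ge0// ltW.
have x1 : abs x <= 1.
  by apply: le_trans xN _; rewrite exprn_ile1// ltW// (invq_lt1 habs).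
apply: le_trans (Ialpha_le habs hmu d0 C0 gC x0 x1 vA) _.
rewrite !mulrA ler_wpM2r// /profile_bound -/p.
have -> : `|Ialpha_const q alpha| * 2 * C / (1 - p `^ d) * abs x `^ d =
  k * abs x `^ d by rewrite /k !mulrA.
have xd : abs x `^ d <= eps / (k + 1).
  have pX : p `^ d ^+ N = (p ^+ N) `^ d.
    by rewrite -!powR_mulrn ?powR_ge0 ?ltW// -!powRrM mulrC.
  apply: le_trans (ltW pN); rewrite pX.
  apply: ge0_ler_powR xN; rewrite ?nnegrE ?(abs_ge0 habs)//; first exact: ltW.
  exact/exprn_ge0/ltW.
apply: le_trans (ler_wpM2l k0 xd) _.
by rewrite mulrCA ler_piMr ?(ltW eps0)// ler_pdivrMr ?ltr_pwDr// mul1r lerDl.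
Qed.

Local Notation source u := (fun r : R => f r (u r)).
Let M' := Num.max M `|f 0 u0|.

Lemma source_le (u : R -> R) (y : K) : u 0 = u0 -> `|source u (abs y)| <= M'.
Proof.
move=> uu0; rewrite le_max; have [->|y0] := eqVneq y 0.
  by rewrite (abs0 habs) uu0 lexx orbT.
by rewrite fM.
Qed.

Lemma Ialpha_source_exists (u : R -> R) (x : K) : u 0 = u0 -> abs x <= 1 ->
  Ialpha_exists abs mu alpha (fun y => source u (abs y)) x.
Proof.
move=> uu0 x1 x0; have [C [d [C0 d0 gC]]] := riesz_profile_bound alpha0.
apply: (Ialpha_exists_radial habs hmu d0 C0 gC x0 x1
  (v := source u) (A := M')) => //.
by move=> y _; exact: source_le.
Qed.

(** The factor [(2 * F)^-1] is chosen so that, after the Lipschitz condition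
contributes [F], one half is left. *)
Lemma contraction_radius : exists N : nat,
  (forall (u : R -> R) (x : K), abs x <= q%:R^-1 ^+ N -> u 0 = u0 ->
     `|I (source u) x| <= (2 * F)^-1 * M') /\
  (forall (u w : R -> R) (A : R) (x : K), abs x <= q%:R^-1 ^+ N ->
     u 0 = u0 -> w 0 = u0 ->
     (forall y, abs y <= abs x -> `|u (abs y) - w (abs y)| <= A) ->
     `|I (source u) x - I (source w) x| <= 2^-1 * A).
Proof.
have [|N small] := @Ialpha_small (2 * F)^-1; first by rewrite invr_gt0 mulr_gt0.
have [C [d [C0 d0 gC]]] := riesz_profile_bound alpha0.
exists N; split=> [u x xN uu0|u w A x xN uu0 wu0 uw].
  by apply: (small (source u)) => // y _; exact: source_le.
have A0 : 0 <= A by apply: le_trans (uw x (lexx _)).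
have x1 : abs x <= 1.
  apply: le_trans xN _.
  by rewrite exprn_ile1// ?(ltW (invq_lt1 habs))// ?(ltW (invq_gt0 habs)).
rewrite (@Ialpha_sub _ _ _ _ _ habs hmu _ _ _ d0 C0 gC
  (source u) (source w) M' M')//;
  try by move=> y _; exact: source_le.
have -> : 2^-1 * A = (2 * F)^-1 * (F * A).
  by rewrite invfM -mulrA mulKf// gt_eqF.
apply: (small (fun r => f r (u r) - f r (w r))) => // y yx.
have [->|y0] := eqVneq y 0.
  by rewrite (abs0 habs) uu0 wu0 subrr normr0 mulr_ge0// ltW.
by apply: le_trans (fF _ _ y0) _; rewrite ler_wpM2l ?uw// ltW.
Qed.

(** Uniqueness is stated on every smaller ball, since another solution may be
defined on a smaller ball only. The fixed points are functions of a real
variable, so the map is evaluated at a chosen element [rep r] of absolute value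
[r]; radiality makes the choice irrelevant. *)
Lemma local_solution_exists_unique : exists N : nat,
  (exists u : R -> R, u 0 = u0 /\ forall t : K, abs t <= q%:R^-1 ^+ N ->
     u (abs t) = u0 + I (source u) t) /\
  (forall (u w : R -> R) (r : R), u 0 = u0 -> w 0 = u0 -> r <= q%:R^-1 ^+ N ->
     (forall t : K, abs t <= r -> u (abs t) = u0 + I (source u) t) ->
     (forall t : K, abs t <= r -> w (abs t) = u0 + I (source w) t) ->
     forall t : K, abs t <= r -> w (abs t) = u (abs t)).
Proof.
have [C [d [C0 d0 gC]]] := riesz_profile_bound alpha0.
have [N [Ile Icontr]] := contraction_radius; exists N.
set B := (2 * F)^-1 * M' in Ile.
split; last first.
  move=> u w r uu0 wu0 rN us ws t tr; apply/subr0_eq.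
  (* Both solutions are within [B] of [u0], which starts the halving. *)
  apply: (@le_halves_eq0 _ (2 * B)) => n; elim: n t tr => [|n IH] t tr.
    rewrite expr0 mulr1 us// ws// opprD addrACA subrr add0r.
    apply: (le_trans (ler_normB _ _)).
    by rewrite mulr2n mulrDl mul1r lerD// Ile// (le_trans tr).
  rewrite us// ws// opprD addrACA subrr add0r exprS mulrCA.
  apply: Icontr => // [|y yt]; first exact: le_trans rN.
  by apply: IH; exact: le_trans yt tr.
pose rep r : K := xget 0 [set x | abs x = r].
have repE t : abs (rep (abs t)) = abs t.
  exact: (@xgetI _ 0 [set x | abs x = abs t] t).
pose T (u : R -> R) r := u0 + I (source u) (rep r).
have T0 u : T u 0 = u0.
  have -> : 0 = abs 0 by rewrite (abs0 habs).
  rewrite /T; suff -> : rep (abs 0) = 0 by rewrite /Ialpha eqxx addr0.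
  by apply/(abs_eq0 habs); rewrite repE (abs0 habs).
have TE u t : u 0 = u0 -> abs t <= q%:R^-1 ^+ N ->
    T u (abs t) = u0 + I (source u) t.
  move=> uu0 tN; congr (_ + _).
  apply: (@Ialpha_radial _ _ _ _ _ habs hmu _ _ _ d0 C0 gC (source u) M') => //.
    rewrite repE; apply: le_trans tN _.
    by rewrite exprn_ile1// ?(ltW (invq_lt1 habs))// ?(ltW (invq_gt0 habs)).
  by move=> y _; exact: source_le.
pose U n := iter n T (fun=> u0).
have U0 n : U n 0 = u0 by case: n => [//|n]; exact: T0.
have Ustep n t : abs t <= q%:R^-1 ^+ N ->
    `|U n.+1 (abs t) - U n (abs t)| <= B * 2^-1 ^+ n.
  elim: n t => [|n IH] t tN.
    by rewrite expr0 mulr1 [U 1%N _]TE// addrAC subrr add0r Ile.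
  rewrite [U n.+2 _]TE// [U n.+1 _]TE// opprD addrACA subrr add0r exprS mulrCA.
  by apply: Icontr => // y yt; apply: IH; exact: le_trans yt tN.
have limU r : exists l, (exists2 t, abs t = r & abs t <= q%:R^-1 ^+ N) ->
    forall n, `|l - U n r| <= 2 * B * 2^-1 ^+ n.
  have [[t <- tN]|nt] := pselect (exists2 t, abs t = r & abs t <= q%:R^-1 ^+ N);
    last by exists 0.
  have [l lP] := @halving_steps_limit R (fun n => U n (abs t)) B
    (fun n => Ustep n t tN).
  by exists l.
(* Off the values of [abs] on the ball, the function [u] is arbitrary. *)
have [u uP] := choice limU.
have uU t n : abs t <= q%:R^-1 ^+ N ->
    `|u (abs t) - U n (abs t)| <= 2 * B * 2^-1 ^+ n.
  by move=> tN; apply: uP; exists t.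
have uu0 : u 0 = u0.
  apply/subr0_eq/(@le_halves_eq0 _ (2 * B)) => n.
  have := uU 0 n; rewrite (abs0 habs) U0; apply.
  by rewrite exprn_ge0// ltW// (invq_gt0 habs).
exists u; split => // t tN; apply/subr0_eq/(@le_halves_eq0 _ (2 * B)) => n.
have E : u (abs t) - (u0 + I (source u) t) = (u (abs t) - U n.+1 (abs t)) +
    (I (source (U n)) t - I (source u) t).
  by rewrite [U n.+1 _]TE// -/(U n); lra.
rewrite E; apply: (le_trans (ler_normD _ _)).
have h1 := uU t n.+1 tN.
have h2 : `|I (source (U n)) t - I (source u) t| <= 2^-1 * (2 * B * 2^-1 ^+ n).
  apply: Icontr => // y yt; rewrite distrC; apply: uU; exact: le_trans yt tN.
by apply: (le_trans (lerD h1 h2)); rewrite exprS; set z := _ ^+ n; lra.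
Qed.

End MildSolutions.

Theorem theorem1 (R : realType) (K : topologicalFieldType) (q : nat)
    (abs : K -> R) (mu : {measure set (borel K) -> \bar R})
    (alpha u0 M F : R) (f : R -> R -> R)
    (hK : nonarch_local_field K)
    (habs : normalized_abs abs q)
    (hmu : normalized_haar abs mu)
    (halpha : 0 < alpha) (hM : 0 < M) (hF : 0 < F)
    (hf_bounded : forall (t : K) (x : R), t != 0 -> `|f (abs t) x| <= M)
    (hf_lipschitz : forall (t : K) (x y : R), t != 0 ->
       `|f (abs t) x - f (abs t) y| <= F * `|x - y|) :
  exists (N : int) (u : R -> R),
    local_mild_solution q abs mu alpha f u0 N u /\
    forall (N' : int) (ubar : R -> R),
      local_mild_solution q abs mu alpha f u0 N' ubar ->
      exists Nbar : int, Nbar <= N /\ Nbar <= N' /\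
        forall t : K, abs t <= q%:R ^ Nbar -> ubar (abs t) = u (abs t).
Proof.
have [N [[u [uu0 usol]] uniq]] :=
  local_solution_exists_unique u0 habs hmu halpha hF hf_bounded hf_lipschitz.
have q1 : 1 <= q%:R :> R by rewrite ler1n ltnW// (q_gt1 habs).
have qN : q%:R ^ (- N%:Z) = q%:R^-1 ^+ N :> R by rewrite -exprnN exprVn.
have pN1 : q%:R^-1 ^+ N <= 1 :> R.
  by rewrite exprn_ile1// ?(ltW (invq_lt1 habs))// ?(ltW (invq_gt0 habs)).
exists (- N%:Z), u; split.
  move=> t; rewrite qN => tN; split; last exact: usol.
  exact: (Ialpha_source_exists habs hmu halpha hf_bounded uu0
    (le_trans tN pN1)).
move=> N' w wsol; exists (Num.min (- N%:Z) N'); rewrite !ge_min !lexx orbT.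
do 2!split => //.
have le_min k (t : K) : Num.min (- N%:Z) N' <= k ->
    abs t <= q%:R ^ Num.min (- N%:Z) N' -> abs t <= q%:R ^ k.
  by move=> mk tm; apply: le_trans tm _; rewrite ler_weXz2l.
have wu0 : w 0 = u0.
  have [|_] := wsol 0; first by rewrite (abs0 habs) exprz_ge0.
  by rewrite /Ialpha eqxx addr0 (abs0 habs).
apply: uniq => //.
- by rewrite -qN ler_weXz2l// ge_min lexx.
- move=> t tm; apply: usol; rewrite -qN; apply: le_min tm.
  by rewrite ge_min lexx.
- move=> t tm; apply: (wsol t _).2; apply: le_min tm.
  by rewrite ge_min lexx orbT.
Qed.
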